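(* For every sequence $\vec{R} = (R_n : n \in \omega)$ of subsets of $\omega$ (of arbitrary complexity), there exists an $\vec{R}$-cohesive set $G$ which is of non-PA Turing degree.
   Context: For a sequence $\vec{R} = (R_n: n\in\omega)$ of subsets of $\omega$, an $\vec{R}$-cohesive set is an infinite set $C \subseteq \omega$ such that for each $n$, either $C \setminus R_n$ or $C \cap R_n$ is finite. A function $f:\omega\to 2$ is PA if $f(e) \neq \Phi_e(\emptyset; e)$ whenever $\Phi_e(\emptyset;e)$ converges (where $\Phi_e$ is the $e$-th Turing functional). A set $X$ is of PA degree if $X$ computes a PA function; otherwise it is of non-PA degree. *)

(* Defs.v *)
From mathcomp Require Import all_boot.
From mathcomp Require Import boolp classical_sets cardinality.
From mathcomp Require Import zify.
From Stdlib Require Arith.Cantor.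

Set Implicit Arguments.
Unset Strict Implicit.
Unset Printing Implicit Defensive.

Local Open Scope classical_set_scope.

(** Turing functionals are presented as Kleene's partial recursive functionals
    of a set oracle. Functions are unary: several arguments are packed into one
    by Cantor's pairing bijection [nat * nat -> nat]. *)

Definition pair_nat (x y : nat) : nat := Cantor.to_nat (x, y).
Definition fst_nat (x : nat) : nat := (Cantor.of_nat x).1.
Definition snd_nat (x : nat) : nat := (Cantor.of_nat x).2.

Inductive code : Type :=
  | Zero
  | Succ
  | Fst
  | Snd
  | Oracle
  | Pair of code & code
  | Comp of code & code
  | Rec of code & code
  | Mu of code.

(** Partial functions are represented by their graphs. *)

(** [h(a, 0) = f(a)] and [h(a, n + 1) = g(a, (n, h(a, n)))]. *)
Fixpoint rec_graph (f g : nat -> nat -> Prop) (a n y : nat) : Prop :=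
  match n with
  | 0 => f a y
  | n'.+1 => exists z, rec_graph f g a n' z /\ g (pair_nat a (pair_nat n' z)) y
  end.

(** Least zero of [f(x, -)]; all the earlier values must be defined. *)
Definition mu_graph (f : nat -> nat -> Prop) (x y : nat) : Prop :=
  f (pair_nat x y) 0 /\
  forall i, i < y -> exists k, f (pair_nat x i) k.+1.

(** [eval A c x y]: the program [c] with oracle [A] halts on [x] with output
    [y]. The oracle answers [1] on elements of [A] and [0] elsewhere. *)
Fixpoint eval (A : set nat) (c : code) (x y : nat) : Prop :=
  match c with
  | Zero => y = 0
  | Succ => y = x.+1
  | Fst => y = fst_nat x
  | Snd => y = snd_nat x
  | Oracle => y = nat_of_bool `[< A x >]
  | Pair f g => exists a b, [/\ eval A f x a, eval A g x b & y = pair_nat a b]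
  | Comp f g => exists z, eval A g x z /\ eval A f z y
  | Rec f g => rec_graph (eval A f) (eval A g) (fst_nat x) (snd_nat x) y
  | Mu f => mu_graph (eval A f) x y
  end.

(** Effective bijective numbering of programs. The first argument of
    [decode_rec] is fuel; fuel [n] suffices to decode [n], see [decodeK]. *)
Fixpoint decode_rec (k n : nat) : code :=
  match k, n with
  | _, 0 => Zero
  | _, 1 => Succ
  | _, 2 => Fst
  | _, 3 => Snd
  | _, 4 => Oracle
  | 0, _ => Zero
  | k'.+1, m.+4.+1 =>
      let d := m %/ 4 in
      match m %% 4 with
      | 0 => Pair (decode_rec k' (fst_nat d)) (decode_rec k' (snd_nat d))
      | 1 => Comp (decode_rec k' (fst_nat d)) (decode_rec k' (snd_nat d))
      | 2 => Rec (decode_rec k' (fst_nat d)) (decode_rec k' (snd_nat d))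
      | _ => Mu (decode_rec k' d)
      end
  end.

Definition decode (n : nat) : code := decode_rec n n.

Fixpoint encode (c : code) : nat :=
  match c with
  | Zero => 0
  | Succ => 1
  | Fst => 2
  | Snd => 3
  | Oracle => 4
  | Pair f g => (pair_nat (encode f) (encode g) * 4 + 0).+4.+1
  | Comp f g => (pair_nat (encode f) (encode g) * 4 + 1).+4.+1
  | Rec f g => (pair_nat (encode f) (encode g) * 4 + 2).+4.+1
  | Mu f => (encode f * 4 + 3).+4.+1
  end.

(** [Phi e A x y] reads "Phi_e(A; x) converges to y". *)
Definition Phi (e : nat) (A : set nat) (x y : nat) : Prop :=
  eval A (decode e) x y.

Definition computes (A : set nat) (f : nat -> bool) : Prop :=
  exists e, forall n, Phi e A n (nat_of_bool (f n)).

Definition PA_function (f : nat -> bool) : Prop :=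
  forall e y, Phi e set0 e y -> nat_of_bool (f e) <> y.

Definition PA_degree (A : set nat) : Prop :=
  exists f, PA_function f /\ computes A f.

Definition cohesive (R : nat -> set nat) (C : set nat) : Prop :=
  infinite_set C /\
  forall n, finite_set (C `\` R n) \/ finite_set (C `&` R n).

(** Sanity checks: convergence is single-valued and the numbering is a
    bijection. *)

Lemma pair_natK1 x y : fst_nat (pair_nat x y) = x.
Proof. by rewrite /fst_nat /pair_nat Cantor.cancel_of_to. Qed.

Lemma pair_natK2 x y : snd_nat (pair_nat x y) = y.
Proof. by rewrite /snd_nat /pair_nat Cantor.cancel_of_to. Qed.

Lemma pair_natE x : pair_nat (fst_nat x) (snd_nat x) = x.
Proof.
by rewrite /pair_nat /fst_nat /snd_nat -surjective_pairing Cantor.cancel_to_of.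
Qed.

Lemma fst_snd_nat_le x : fst_nat x + snd_nat x <= x.
Proof.
rewrite -{3}(pair_natE x) /pair_nat.
have := Cantor.to_nat_non_decreasing (fst_nat x) (snd_nat x); lia.
Qed.

Lemma eval_inj A c x y z : eval A c x y -> eval A c x z -> y = z.
Proof.
elim: c x y z => [||||| f IHf g IHg | f IHf g IHg | f IHf g IHg | f IHf] x y z
  /=; try by move=> -> ->.
- move=> [a [b [Ha Hb ->]]] [a' [b' [Ha' Hb' ->]]].
  by rewrite (IHf _ _ _ Ha Ha') (IHg _ _ _ Hb Hb').
- move=> [a [Ha Hy]] [b [Hb Hz]].
  by rewrite (IHg _ _ _ Ha Hb) in Hy; apply: IHf Hy Hz.
- move: (fst_nat x) (snd_nat x) => a n.
  elim: n y z => [|n IHn] y z /=; first exact: IHf.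
  move=> [u [Hu Hy]] [v [Hv Hz]].
  by rewrite (IHn _ _ Hu Hv) in Hy; apply: IHg Hy Hz.
- move=> [Hy Ly] [Hz Lz]; case: (ltngtP y z) => // [/Lz | /Ly] [k Hk].
  + by have := IHf _ _ _ Hy Hk.
  + by have := IHf _ _ _ Hz Hk.
Qed.

Lemma encodeK : cancel encode decode.
Proof.
rewrite /decode => c.
suff H k d : encode d <= k -> decode_rec k (encode d) = d by exact: H.
elim: k d => [|k IHk] [||||| f g | f g | f g | f] //= Hk.
all: rewrite divnMDl // modnMDl addn0 /=.
4: by rewrite IHk //; lia.
all: have := fst_snd_nat_le (pair_nat (encode f) (encode g)).
all: by rewrite pair_natK1 pair_natK2 => Hp; rewrite !IHk //; lia.
Qed.

Lemma decodeK : cancel decode encode.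
Proof.
rewrite /decode => n.
suff H k m : m <= k -> encode (decode_rec k m) = m by exact: H.
elim: k m => [|k IHk] [|[|[|[|[|m]]]]] //= Hk.
have Em := divn_eq m 4; have Hd := fst_snd_nat_le (m %/ 4).
have Hlt : m %% 4 < 4 by rewrite ltn_mod.
case Er: (m %% 4) Hlt => [|[|[|[|r]]]] //= _; rewrite Er in Em.
4: by rewrite IHk -?Em //; lia.
all: by rewrite !IHk ?pair_natE -?Em //; lia.
Qed.

(* Main.v *)
Require Import Defs.
From mathcomp Require Import all_boot.
From mathcomp Require Import boolp classical_sets cardinality.
From mathcomp Require Import zify.
From Stdlib Require Import Wellfounded Relations.
From Stdlib Require Arith.Cantor.

(** Mathias forcing with reservoirs of non-PA degree: the finite stems are
    extended so as to hit the diagonal function [n |-> Phi_n(0; n)] or to force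
    divergence, and the [n]-th reservoir is shrunk into [R n] or its complement.
    The shrinking is Liu's theorem: if [X] is infinite of non-PA degree, then
    one of [X /\ A], [X \ A] has an infinite subset of non-PA degree.

    Suppose not. Then all attempts to build such a subset inside either half
    get stuck, i.e., they form well-founded trees. Consider finite colorings of
    a final segment of [X] whose color classes each carry two attempts, one for
    each half, and satisfy the divergence promises made so far. Given numbers
    [n_1 .. n_d] and bits [v_1 .. v_d], ask for such a coloring in which no
    attempt can be extended within its class and half to give a value [v_j]
    at [n_j]. By compactness, the absence of a coloring is semirecursive in
    [X]. If it occurs at a vector on the diagonal, the partition of [X] into
    its two halves shows that some attempt can hit the diagonal. Otherwise,
    as [X] is of non-PA degree, some [n_1 .. n_d] has colorings for all
    [2 ^ d] vectors; when [2 ^ d] exceeds the number of colors, every point has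
    the same color for two different vectors, and on the common refinement
    each class forces divergence of one of its attempts. Either way some
    attempts advance, so the multiset of pairs of attempts would decrease
    forever. *)

Set Implicit Arguments.
Unset Strict Implicit.
Unset Printing Implicit Defensive.

(** * Recursive functions and semirecursive sets relative to an oracle *)

Definition recursive_in (A : set nat) (F : nat -> nat) : Prop :=
  exists c, forall x, eval A c x (F x).

Lemma recursive_id A : recursive_in A (fun z => z).
Proof. by exists (Pair Fst Snd) => x /=; exists (fst_nat x), (snd_nat x); rewrite pair_natE. Qed.

Lemma recursive_comp A F G :
  recursive_in A F -> recursive_in A G -> recursive_in A (fun z => F (G z)).
Proof. by move=> [c Hc] [d Hd]; exists (Comp c d) => x /=; exists (G x). Qed.

Lemma recursive_succ A F : recursive_in A F -> recursive_in A (fun z => (F z).+1).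
Proof. by apply: recursive_comp; exists Succ. Qed.

Lemma recursive_fst A F : recursive_in A F -> recursive_in A (fun z => fst_nat (F z)).
Proof. by apply: recursive_comp; exists Fst. Qed.

Lemma recursive_snd A F : recursive_in A F -> recursive_in A (fun z => snd_nat (F z)).
Proof. by apply: recursive_comp; exists Snd. Qed.

Lemma recursive_cst A k : recursive_in A (fun=> k).
Proof. by elim: k => [|k IH]; [exists Zero | apply: recursive_succ]. Qed.

Lemma recursive_pair A F G :
  recursive_in A F -> recursive_in A G -> recursive_in A (fun z => pair_nat (F z) (G z)).
Proof. by move=> [c Hc] [d Hd]; exists (Pair c d) => x /=; exists (F x), (G x). Qed.

Lemma recursive_oracle A F :
  recursive_in A F -> recursive_in A (fun z => nat_of_bool `[< A (F z) >]).
Proof. by apply: (@recursive_comp A (fun x => nat_of_bool `[< A x >])); exists Oracle. Qed.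

Lemma recursive_prim A F G (H : nat -> nat -> nat) S T :
  recursive_in A F -> recursive_in A G ->
  (forall a, H a 0 = F a) ->
  (forall a n, H a n.+1 = G (pair_nat a (pair_nat n (H a n)))) ->
  recursive_in A S -> recursive_in A T -> recursive_in A (fun z => H (S z) (T z)).
Proof.
move=> [c Hc] [d Hd] H0 HS RS RT.
have: recursive_in A (fun z => H (fst_nat z) (snd_nat z)).
  exists (Rec c d) => x /=.
  elim: (snd_nat x) => [|n IH] /=; first by rewrite H0.
  by exists (H (fst_nat x) n); rewrite HS.
move=> RH; have [e He] := recursive_comp RH (recursive_pair RS RT).
by exists e => x; have := He x; rewrite pair_natK1 pair_natK2.
Qed.

Lemma recursive_add A F G :
  recursive_in A F -> recursive_in A G -> recursive_in A (fun z => F z + G z).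
Proof.
move=> RF RG.
apply: (@recursive_prim A id (fun z => (snd_nat (snd_nat z)).+1) addn) => //.
- exact: recursive_id.
- by apply/recursive_succ/recursive_snd/recursive_snd/recursive_id.
- by move=> a; rewrite addn0.
- by move=> a n; rewrite !pair_natK2 addnS.
Qed.

Lemma recursive_pred A F : recursive_in A F -> recursive_in A (fun z => (F z).-1).
Proof.
move=> RF.
apply: (@recursive_prim A (fun=> 0) (fun z => fst_nat (snd_nat z)) (fun _ n => n.-1) F) => //.
- exact: recursive_cst.
- by apply/recursive_fst/recursive_snd/recursive_id.
- by move=> a n; rewrite pair_natK2 pair_natK1.
Qed.

Lemma recursive_sub A F G :
  recursive_in A F -> recursive_in A G -> recursive_in A (fun z => F z - G z).
Proof.
move=> RF RG.
apply: (@recursive_prim A id (fun z => (snd_nat (snd_nat z)).-1) subn) => //.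
- exact: recursive_id.
- by apply/recursive_pred/recursive_snd/recursive_snd/recursive_id.
- by move=> a; rewrite subn0.
- by move=> a n; rewrite !pair_natK2 subnS.
Qed.

Lemma recursive_mul A F G :
  recursive_in A F -> recursive_in A G -> recursive_in A (fun z => F z * G z).
Proof.
move=> RF RG.
apply: (@recursive_prim A (fun=> 0) (fun z => fst_nat z + snd_nat (snd_nat z)) muln) => //.
- exact: recursive_cst.
- apply: recursive_add; first exact/recursive_fst/recursive_id.
  by apply/recursive_snd/recursive_snd/recursive_id.
- by move=> a; rewrite muln0.
- by move=> a n; rewrite !pair_natK2 pair_natK1 mulnS.
Qed.

(** Every number codes an infinite sequence, almost all of whose entries
    are [0]: its head is [fst_nat], its tail [snd_nat]. *)
Definition proj (i u : nat) : nat := fst_nat (iter i snd_nat u).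

Lemma projS i u : proj i.+1 u = proj i (snd_nat u).
Proof. by rewrite /proj iterSr. Qed.

Lemma proj_pair0 x u : proj 0 (pair_nat x u) = x.
Proof. exact: pair_natK1. Qed.

Lemma proj_pairS i x u : proj i.+1 (pair_nat x u) = proj i u.
Proof. by rewrite projS pair_natK2. Qed.

(** A positive head leaves less for the tail; with head [0], Cantor's formula makes the code exceed
    any positive tail. Hence iterated tails reach [0]. *)
Lemma snd_nat_lt u : 0 < u -> snd_nat u < u.
Proof.
move=> u0; have := fst_snd_nat_le u; rewrite leq_eqVlt => /orP[/eqP E|]; last lia.
have [f0|] := posnP (fst_nat u); last lia.
have := pair_natE u; rewrite f0 /pair_nat.
case: (snd_nat u) E u0 => [|n] E u0; first lia.
have := Cantor.to_nat_spec 0 n.+1; rewrite -/(Nat.add _ _); nia.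
Qed.

Lemma proj_ge i u : u <= i -> proj i u = 0.
Proof.
elim: i u => [|i IH] u ui; first by have -> : u = 0 by lia.
rewrite projS IH //; have [->//|/snd_nat_lt] := posnP u; lia.
Qed.

Lemma leq_pair_nat x y x' y' : x <= x' -> y <= y' -> pair_nat x y <= pair_nat x' y'.
Proof.
move=> xx yy; rewrite /pair_nat.
have := Cantor.to_nat_spec x y; have := Cantor.to_nat_spec x' y'; nia.
Qed.

(** Turns a quantifier over sequences of length [l] with entries below [K] into a bounded one over
    codes. *)
Fixpoint seq_bound (K l : nat) : nat :=
  if l is l'.+1 then pair_nat K (seq_bound K l') else 0.

Lemma proj_surj_bound K l (g : nat -> nat) : (forall i, i < l -> g i < K) ->
  exists2 u, u <= seq_bound K l & forall i, i < l -> proj i u = g i.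
Proof.
elim: l g => [|l IH] g gK; first by exists 0.
have [i il|u ub Hu] := IH (fun i => g i.+1); first exact: gK.
exists (pair_nat (g 0) u) => [|[|i] il]; first by apply: leq_pair_nat => //; apply/ltnW/gK.
  by rewrite proj_pair0.
by rewrite proj_pairS Hu.
Qed.

Lemma proj_surj l (g : nat -> nat) :
  exists u, forall i, proj i u = if i < l then g i else 0.
Proof.
elim: l g => [|l IH] g; first by exists 0 => i; rewrite proj_ge.
have [u Hu] := IH (fun i => g i.+1); exists (pair_nat (g 0) u) => -[|i].
  by rewrite proj_pair0.
by rewrite proj_pairS Hu ltnS.
Qed.

Lemma recursive_proj A F G :
  recursive_in A F -> recursive_in A G -> recursive_in A (fun z => proj (F z) (G z)).
Proof.
move=> RF RG; apply: recursive_fst.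
apply: (@recursive_prim A id (fun z => snd_nat (snd_nat (snd_nat z)))
  (fun a n => iter n snd_nat a) G F) => //.
- exact: recursive_id.
- by apply/recursive_snd/recursive_snd/recursive_snd/recursive_id.
- by move=> a n /=; rewrite !pair_natK2.
Qed.

Lemma recursive_seq_bound A K F :
  recursive_in A F -> recursive_in A (fun z => seq_bound K (F z)).
Proof.
move=> RF.
apply: (@recursive_prim A (fun=> 0) (fun z => pair_nat K (snd_nat (snd_nat z)))
  (fun _ => seq_bound K) F F) => //.
- exact: recursive_cst.
- apply: recursive_pair; first exact: recursive_cst.
  by apply/recursive_snd/recursive_snd/recursive_id.
- by move=> a n /=; rewrite !pair_natK2.
Qed.

Ltac recur := lazymatch goal with
  | |- recursive_in _ (fun=> ?k) => exact: recursive_cst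
  | |- recursive_in _ (fun z => z) => exact: recursive_id
  | |- recursive_in _ fst_nat => by exists Fst
  | |- recursive_in _ snd_nat => by exists Snd
  | |- recursive_in _ (fun z => (@?F z).+1) => apply: (@recursive_succ _ F); recur
  | |- recursive_in _ (fun z => fst_nat (@?F z)) => apply: (@recursive_fst _ F); recur
  | |- recursive_in _ (fun z => snd_nat (@?F z)) => apply: (@recursive_snd _ F); recur
  | |- recursive_in _ (fun z => pair_nat (@?F z) (@?G z)) =>
      apply: (@recursive_pair _ F G); recur
  | |- recursive_in _ (fun z => addn (@?F z) (@?G z)) =>
      apply: (@recursive_add _ F G); recur
  | |- recursive_in _ (fun z => muln (@?F z) (@?G z)) =>
      apply: (@recursive_mul _ F G); recur
  | |- recursive_in _ (fun z => subn (@?F z) (@?G z)) =>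
      apply: (@recursive_sub _ F G); recur
  | |- recursive_in _ (fun z => proj (@?F z) (@?G z)) =>
      apply: (@recursive_proj _ F G); recur
  | |- recursive_in _ (fun z => seq_bound ?K (@?F z)) =>
      apply: (@recursive_seq_bound _ K F); recur
  | |- recursive_in ?A (fun z => nat_of_bool (asbool (?A (@?F z)))) =>
      apply: (@recursive_oracle A F); recur
  | |- recursive_in _ (fun z => ?F (@?G z)) => apply: (@recursive_comp _ F G); [try assumption | recur]
  end.

Definition semirec (A : set nat) (P : nat -> Prop) : Prop :=
  exists2 F, recursive_in A F & forall x, P x <-> exists y, F (pair_nat x y) = 0.

Lemma semirec_iff A P Q : (forall x, P x <-> Q x) -> semirec A P -> semirec A Q.
Proof. by move=> PQ [F RF HF]; exists F => // x; rewrite -PQ. Qed.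

Lemma semirec_comp A P G :
  recursive_in A G -> semirec A P -> semirec A (fun z => P (G z)).
Proof.
move=> RG [F RF HF]; exists (fun z => F (pair_nat (G (fst_nat z)) (snd_nat z))).
  by recur.
by move=> x; rewrite HF; split=> -[y Hy]; exists y; move: Hy; rewrite pair_natK1 pair_natK2.
Qed.

Lemma semirec_eq A F G :
  recursive_in A F -> recursive_in A G -> semirec A (fun z => F z = G z).
Proof.
move=> RF RG.
exists (fun z => (F (fst_nat z) - G (fst_nat z)) + (G (fst_nat z) - F (fst_nat z))).
  by recur.
move=> x; split=> [E|[y]]; last by rewrite pair_natK1; lia.
by exists 0; rewrite pair_natK1 E; lia.
Qed.

Lemma semirec_and A P Q :
  semirec A P -> semirec A Q -> semirec A (fun z => P z /\ Q z).
Proof.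
move=> [F RF HF] [G RG HG].
exists (fun z => F (pair_nat (fst_nat z) (fst_nat (snd_nat z)))
  + G (pair_nat (fst_nat z) (snd_nat (snd_nat z)))); first by recur.
move=> x; rewrite HF HG; split=> [[[y Hy] [z Hz]]|[y]].
  by exists (pair_nat y z); rewrite !(pair_natK1, pair_natK2) Hy Hz.
rewrite !(pair_natK1, pair_natK2) => E.
by split; [exists (fst_nat y) | exists (snd_nat y)]; lia.
Qed.

Lemma semirec_or A P Q :
  semirec A P -> semirec A Q -> semirec A (fun z => P z \/ Q z).
Proof.
move=> [F RF HF] [G RG HG].
exists (fun z => F z * G z); first by recur.
move=> x; rewrite HF HG; split=> [[[y Hy]|[y Hy]]|[y /eqP]].
- by exists y; rewrite Hy.
- by exists y; rewrite Hy muln0.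
- by rewrite muln_eq0 => /orP[]/eqP E; [left|right]; exists y.
Qed.

Lemma semirec_ex A (P : nat -> nat -> Prop) :
  semirec A (fun z => P (fst_nat z) (snd_nat z)) -> semirec A (fun z => exists y, P z y).
Proof.
move=> [F RF HF].
exists (fun z => F (pair_nat (pair_nat (fst_nat z) (fst_nat (snd_nat z))) (snd_nat (snd_nat z)))).
  by recur.
have E z i : P z i <-> exists y, F (pair_nat (pair_nat z i) y) = 0.
  by have := HF (pair_nat z i); rewrite pair_natK1 pair_natK2.
move=> x; split=> [[y /E[z Hz]]|[y]].
  by exists (pair_nat y z); rewrite !(pair_natK1, pair_natK2).
by rewrite !(pair_natK1, pair_natK2) => H; exists (fst_nat y); apply/E; exists (snd_nat y).
Qed.

(** The witnesses for all [i < T z] are packed into one coded sequence, and the matrix is a sum that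
    vanishes exactly when each term does. *)
Lemma semirec_ball A (P : nat -> nat -> Prop) T : recursive_in A T ->
  semirec A (fun z => P (fst_nat z) (snd_nat z)) ->
  semirec A (fun z => forall i, i < T z -> P z i).
Proof.
move=> RT [F RF HF].
pose H a n := \sum_(i < n) F (pair_nat (pair_nat (fst_nat a) i) (proj i (snd_nat a))).
exists (fun z => H z (T (fst_nat z))).
  apply: (@recursive_prim A (fun=> 0) (fun z => snd_nat (snd_nat z) +
    F (pair_nat (pair_nat (fst_nat (fst_nat z)) (fst_nat (snd_nat z)))
      (proj (fst_nat (snd_nat z)) (snd_nat (fst_nat z))))) H id _).
  - by recur.
  - by recur.
  - by move=> a; rewrite /H big_ord0.
  - by move=> a n; rewrite /H big_ord_recr /= !(pair_natK1, pair_natK2).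
  - exact: recursive_id.
  - by recur.
have E z i : P z i <-> exists y, F (pair_nat (pair_nat z i) y) = 0.
  by have := HF (pair_nat z i); rewrite pair_natK1 pair_natK2.
move=> x; split=> [Hx|[y]]; last first.
  rewrite /H !(pair_natK1, pair_natK2) => /eqP; rewrite sum_nat_eq0 => /forallP E0 i iT.
  by apply/E; exists (proj i y); apply/eqP; exact: (E0 (Ordinal iT)).
have /choice[g Hg] : forall i, exists y, i < T x -> F (pair_nat (pair_nat x i) y) = 0.
  move=> i; have [iT|] := boolP (i < T x); last by exists 0.
  by have /E[y Hy] := Hx _ iT; exists y.
have [y Hy] := proj_surj (T x) g; exists y.
rewrite /H !(pair_natK1, pair_natK2); apply/eqP; rewrite sum_nat_eq0; apply/forallP => -[i iT] /=.
by rewrite Hy iT Hg.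
Qed.

Lemma semirec_lt A F G :
  recursive_in A F -> recursive_in A G -> semirec A (fun z => F z < G z).
Proof.
move=> RF RG; apply: (@semirec_iff _ (fun z => (F z).+1 - G z = 0)).
  by move=> x; lia.
by apply: semirec_eq; recur.
Qed.

Lemma semirec_oracle A F : recursive_in A F -> semirec A (fun z => A (F z)).
Proof.
move=> RF; apply: (@semirec_iff _ (fun z => nat_of_bool `[< A (F z) >] = 1)).
  by move=> x; case: asboolP.
by apply: semirec_eq; recur.
Qed.

Lemma semirec_cst A (P : Prop) : semirec A (fun=> P).
Proof.
apply: (@semirec_iff _ (fun=> nat_of_bool `[< P >] = 1)); first by move=> _; case: asboolP.
by apply: semirec_eq; recur.
Qed.

Lemma semirec_has A (I : eqType) (r : seq I) (P : I -> nat -> Prop) :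
  (forall i, i \in r -> semirec A (P i)) -> semirec A (fun z => exists2 i, i \in r & P i z).
Proof.
elim: r => [|i r IH] H.
  by apply: (@semirec_iff _ (fun=> False)); [move=> z; split=> // -[] | exact: semirec_cst].
apply: (@semirec_iff _ (fun z => P i z \/ exists2 i, i \in r & P i z)).
  move=> z; split=> [[Pi|[k kr Pk]]|[k]].
  - by exists i => //; rewrite mem_head.
  - by exists k => //; rewrite inE kr orbT.
  - by rewrite inE => /orP[/eqP->|kr Pk]; [left | right; exists k].
apply: semirec_or; first by apply: H; rewrite mem_head.
by apply: IH => k kr; apply: H; rewrite inE kr orbT.
Qed.

Ltac semi := lazymatch goal with
  | |- semirec _ (fun=> ?P) => exact: semirec_cst
  | |- semirec _ (fun z => @?P z /\ @?Q z) => apply: (@semirec_and _ P Q); semi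
  | |- semirec _ (fun z => @?P z \/ @?Q z) => apply: (@semirec_or _ P Q); semi
  | |- semirec _ (fun z => exists y, @?P z y) =>
      apply: (@semirec_ex _ P); cbv beta; semi
  | |- semirec _ (fun z => forall i, is_true (i < @?T z) -> @?P z i) =>
      apply: (@semirec_ball _ P T); [recur | cbv beta; semi]
  | |- semirec _ (fun z => @eq nat (@?F z) (@?G z)) => apply: (@semirec_eq _ F G); recur
  | |- semirec _ (fun z => is_true (@?F z < @?G z)) => apply: (@semirec_lt _ F G); recur
  | |- semirec ?A (fun z => ?A (@?F z)) => apply: (@semirec_oracle A F); recur
  end.

(** Uniformization: minimize over coded pairs of a value and a witness, then project to the
    value. *)
Lemma semirec_select A (P : nat -> Prop) : semirec A P ->
  (forall n, exists v, P (pair_nat n v)) ->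
  exists2 g, recursive_in A g & forall n, P (pair_nat n (g n)).
Proof.
move=> [F RF HF] HP.
pose F' z := F (pair_nat (pair_nat (fst_nat z) (fst_nat (snd_nat z))) (snd_nat (snd_nat z))).
have RF' : recursive_in A F' by rewrite /F'; recur.
have ex n : exists y, F' (pair_nat n y) == 0.
  have [v /HF[w Hw]] := HP n; exists (pair_nat v w).
  by rewrite /F' !(pair_natK1, pair_natK2) Hw.
exists (fun n => fst_nat (ex_minn (ex n))); last first.
  move=> n; case: ex_minnP => m /eqP Hm _; apply/HF; exists (snd_nat m).
  by move: Hm; rewrite /F' !(pair_natK1, pair_natK2).
apply: recursive_fst; have [c Hc] := RF'; exists (Mu c) => n /=.
case: ex_minnP => m /eqP Hm Hmin; split=> [|i im]; first by rewrite -Hm.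
exists (F' (pair_nat n i)).-1; rewrite prednK; first exact: Hc.
by rewrite lt0n; apply: contraTneq im => E; rewrite -leqNgt; apply: Hmin; rewrite E.
Qed.

Lemma semirec_PA_degree A (P : nat -> Prop) : semirec A P ->
  (forall n, exists v, P (pair_nat n v)) ->
  (forall n v, P (pair_nat n v) -> v < 2 /\ ~ Phi n set0 n v) -> PA_degree A.
Proof.
move=> SP EP HP; have [g [c Hc] Hg] := semirec_select SP EP.
have gE n : nat_of_bool (g n == 1) = g n by have [] := HP _ _ (Hg n); case: (g n) => [|[|]].
exists (fun n => g n == 1); split.
  by move=> e y He; rewrite gE => E; have [_] := HP _ _ (Hg e); rewrite E.
by exists (encode c) => n; rewrite /Phi encodeK gE.
Qed.

(** * The use principle and universality *)

(** A halting computation asks finitely many questions. For [Mu], an inner induction adds up the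
    uses of all the values before the zero. *)
Lemma eval_use A c x y : eval A c x y ->
  exists u, forall B : set nat, (forall i, i < u -> (A i <-> B i)) -> eval B c x y.
Proof.
elim: c x y => [||||| f IHf g IHg | f IHf g IHg | f IHf g IHg | f IHf] x y /=;
  try by move=> ->; exists 0.
- move=> ->; exists x.+1 => B AB; congr nat_of_bool.
  by apply: asbool_equiv_eq; apply: AB.
- move=> [a [b [/IHf[u Hu] /IHg[v Hv] ->]]]; exists (u + v) => B AB; exists a, b.
  by split=> //; [apply: Hu | apply: Hv] => i iu; apply: AB; lia.
- move=> [a [/IHg[u Hu] /IHf[v Hv]]]; exists (u + v) => B AB; exists a.
  by split; [apply: Hu | apply: Hv] => i iu; apply: AB; lia.
- move: (fst_nat x) (snd_nat x) => a n.
  elim: n y => [|n IHn] y /=; first exact: IHf.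
  move=> [z [/IHn[u Hu] /IHg[v Hv]]]; exists (u + v) => B AB; exists z.
  by split; [apply: Hu | apply: Hv] => i iu; apply: AB; lia.
- move=> [/IHf[u Hu] H].
  have: exists v, forall B : set nat, (forall i, i < v -> (A i <-> B i)) ->
      forall i, i < y -> exists k, eval B f (pair_nat x i) k.+1.
    elim: y {Hu} H => [|y IH] H; first by exists 0.
    have [|v Hv] := IH; first by move=> i iy; apply: H; lia.
    have [k /IHf[v' Hv']] := H y (leqnn _).
    exists (v + v') => B AB i; rewrite ltnS leq_eqVlt => /orP[/eqP->|iy].
      by exists k; apply: Hv' => j jv; apply: AB; lia.
    by apply: Hv => // j jv; apply: AB; lia.
  move=> [v Hv]; exists (u + v) => B AB; split.
    by apply: Hu => i iu; apply: AB; lia.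
  by apply: Hv => i iu; apply: AB; lia.
Qed.

(** Entries other than [1] count as non-membership; the set is finite since the entries from [u] on
    vanish. *)
Definition finset_of (u : nat) : set nat := fun x => proj x u = 1.

Lemma decode_Pair f g : decode (pair_nat f g * 4 + 0).+4.+1 = Pair (decode f) (decode g).
Proof. by rewrite -[RHS]encodeK /= !decodeK. Qed.

Lemma decode_Comp f g : decode (pair_nat f g * 4 + 1).+4.+1 = Comp (decode f) (decode g).
Proof. by rewrite -[RHS]encodeK /= !decodeK. Qed.

Lemma decode_Rec f g : decode (pair_nat f g * 4 + 2).+4.+1 = Rec (decode f) (decode g).
Proof. by rewrite -[RHS]encodeK /= !decodeK. Qed.

Lemma decode_Mu f : decode (f * 4 + 3).+4.+1 = Mu (decode f).
Proof. by rewrite -[RHS]encodeK /= decodeK. Qed.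

(** One inference step of the evaluation relation for the oracle
    [finset_of u], from premises in [M]. *)
Definition justified (u : nat) (M : nat -> nat -> nat -> Prop) (e x y : nat) : Prop :=
  (e = 0 /\ y = 0) \/ (e = 1 /\ y = x.+1) \/ (e = 2 /\ y = fst_nat x) \/
  (e = 3 /\ y = snd_nat x) \/
  (e = 4 /\ ((proj x u = 1 /\ y = 1) \/
             ((proj x u = 0 \/ 1 < proj x u) /\ y = 0))) \/
  (exists f, exists g, e = (pair_nat f g * 4 + 0).+4.+1 /\
    exists a, exists b, M f x a /\ M g x b /\ y = pair_nat a b) \/
  (exists f, exists g, e = (pair_nat f g * 4 + 1).+4.+1 /\
    exists z, M g x z /\ M f z y) \/
  (exists f, exists g, e = (pair_nat f g * 4 + 2).+4.+1 /\
    ((snd_nat x = 0 /\ M f (fst_nat x) y) \/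
     exists n, exists z, snd_nat x = n.+1 /\ M e (pair_nat (fst_nat x) n) z /\
       M g (pair_nat (fst_nat x) (pair_nat n z)) y)) \/
  (exists f, e = (f * 4 + 3).+4.+1 /\ M f (pair_nat x y) 0 /\
    forall i, i < y -> exists k, M f (pair_nat x i) k.+1).

Lemma justified_mono u (M M' : nat -> nat -> nat -> Prop) e x y :
  (forall e x y, M e x y -> M' e x y) -> justified u M e x y -> justified u M' e x y.
Proof.
move=> MM'; rewrite /justified; do 5![case; [by tauto|]].
case=> [[f [g [-> [a [b [? [? ->]]]]]]]|].
  by do 5!right; left; exists f, g; split=> //; exists a, b; do !split=> //; apply: MM'.
case=> [[f [g [-> [z [? ?]]]]]|].
  by do 6!right; left; exists f, g; split=> //; exists z; split=> //; apply: MM'.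
case=> [[f [g [-> [[? ?]|[n [z [? [? ?]]]]]]]]|].
- by do 7!right; left; exists f, g; split=> //; left; split=> //; apply: MM'.
- by do 7!right; left; exists f, g; split=> //; right; exists n, z; do !split=> //; apply: MM'.
move=> [f [-> [? H]]]; do 8!right; exists f; do !split=> //; first exact: MM'.
by move=> i /H[k ?]; exists k; apply: MM'.
Qed.

Lemma justified_sound u (M : nat -> nat -> nat -> Prop) e x y :
  (forall e x y, M e x y -> eval (finset_of u) (decode e) x y) ->
  justified u M e x y -> eval (finset_of u) (decode e) x y.
Proof.
move=> MT; rewrite /justified.
case=> [[-> ->] //|]; case=> [[-> ->] //|]; case=> [[-> ->] //|]; case=> [[-> ->] //|].
case=> [[-> H]|].
  rewrite /= /finset_of; case: asboolP => pu; first by case: H => -[? ->] //; lia.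
  by case: H => -[? ->].
case=> [[f [g [-> [a [b [? [? ->]]]]]]]|].
  by rewrite decode_Pair; exists a, b; split=> //; apply: MT.
case=> [[f [g [-> [z [? ?]]]]]|].
  by rewrite decode_Comp; exists z; split; apply: MT.
case=> [[f [g [-> [[E ?]|[n [z [E [/MT]]]]]]]]|].
- by rewrite decode_Rec /= E /=; apply: MT.
- rewrite decode_Rec /= E pair_natK1 pair_natK2 => ? ?.
  by exists z; split=> //; apply: MT.
move=> [f [-> [? H]]]; rewrite decode_Mu; split; first exact: MT.
by move=> i /H[k ?]; exists k; apply: MT.
Qed.

Definition mem_fact (l : seq nat) (e x y : nat) : Prop := pair_nat e (pair_nat x y) \in l.

(** Read from right to left: each fact rests on those after it. *)
Fixpoint derivation (u : nat) (l : seq nat) : Prop :=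
  if l is t :: l' then
    justified u (mem_fact l') (fst_nat t) (fst_nat (snd_nat t)) (snd_nat (snd_nat t))
    /\ derivation u l'
  else True.

Lemma derivation_cat u l1 l2 :
  derivation u l1 -> derivation u l2 -> derivation u (l1 ++ l2).
Proof.
elim: l1 => //= t l1 IH [J D1] D2; split; last exact: IH.
by apply: justified_mono J => e x y; rewrite /mem_fact mem_cat => ->.
Qed.

Definition derivable u (S : seq nat) := exists2 l, derivation u l & {subset S <= l}.

Lemma derivable_cat u S1 S2 : derivable u S1 -> derivable u S2 -> derivable u (S1 ++ S2).
Proof.
move=> [l1 D1 S1l] [l2 D2 S2l]; exists (l1 ++ l2); first exact: derivation_cat.
by move=> t; rewrite !mem_cat => /orP[/S1l|/S2l] ->; rewrite ?orbT.
Qed.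

Lemma derivable_step u S e x y : derivable u S ->
  justified u (mem_fact S) e x y -> derivable u [:: pair_nat e (pair_nat x y)].
Proof.
move=> [l D Sl] J; exists (pair_nat e (pair_nat x y) :: l).
  split=> //; rewrite !(pair_natK1, pair_natK2).
  by apply: justified_mono J => ? ? ?; apply: Sl.
by move=> t; rewrite !inE => ->.
Qed.

Lemma derivable_eval u c x y :
  eval (finset_of u) c x y -> derivable u [:: pair_nat (encode c) (pair_nat x y)].
Proof.
have D0 : derivable u [::] by exists [::].
elim: c x y => [||||| f IHf g IHg | f IHf g IHg | f IHf g IHg | f IHf] x y /=.
1-4: by move=> ->; apply: (derivable_step D0); rewrite /justified; tauto.
- move=> ->; apply: (derivable_step D0); do 4!right; left; split=> //.
  rewrite /finset_of; case: asboolP => pu; [by left | right; split=> //].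
  by case: (proj x u) pu => [|[|n]] //; [left | right].
- move=> [a [b [/IHf Df /IHg Dg ->]]]; apply: (derivable_step (derivable_cat Df Dg)).
  do 5!right; left; exists (encode f), (encode g); split=> //; exists a, b.
  by rewrite /mem_fact !inE !eqxx orbT.
- move=> [z [/IHg Dg /IHf Df]]; apply: (derivable_step (derivable_cat Df Dg)).
  do 6!right; left; exists (encode f), (encode g); split=> //; exists z.
  by rewrite /mem_fact !inE !eqxx orbT.
- rewrite -{3}(pair_natE x); move: (fst_nat x) (snd_nat x) => a n.
  elim: n y => [|n IHn] y /=.
    move=> /IHf Df; apply: (derivable_step Df); do 7!right; left.
    exists (encode f), (encode g); split=> //; left.
    by rewrite /mem_fact pair_natK1 pair_natK2 inE.
  move=> [z [/IHn Dn /IHg Dg]]; apply: (derivable_step (derivable_cat Dn Dg)).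
  do 7!right; left; exists (encode f), (encode g); split=> //; right; exists n, z.
  by rewrite /mem_fact pair_natK1 pair_natK2 !inE !eqxx orbT.
- move=> [/IHf Df H].
  have: exists2 S, derivable u S &
      forall i, i < y -> exists k, mem_fact S (encode f) (pair_nat x i) k.+1.
    elim: y {Df} H => [|y IH] H; first by exists [::].
    have [|S DS HS] := IH; first by move=> i iy; apply: H; lia.
    have [k /IHf Dk] := H y (leqnn _); eexists; first exact: derivable_cat Dk DS.
    move=> i; rewrite ltnS leq_eqVlt => /orP[/eqP->|/HS[k' Hk']].
      by exists k; rewrite /mem_fact mem_head.
    by exists k'; rewrite /mem_fact mem_cat Hk' orbT.
  move=> [S DS HS]; apply: (derivable_step (derivable_cat Df DS)).
  do 8!right; exists (encode f); split=> //; split; first by rewrite /mem_fact mem_head.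
  by move=> i /HS[k Hk]; exists k; rewrite /mem_fact mem_cat Hk orbT.
Qed.

(** Lists become positions in a coded sequence, premises still coming later, so that only numbers
    are quantified. *)
Definition coded_fact (L n j e x y : nat) : Prop :=
  exists k, (j < k /\ k < n) /\ proj k L = pair_nat e (pair_nat x y).

Definition coded_derivation (u L n : nat) : Prop := forall j, j < n ->
  justified u (coded_fact L n j) (fst_nat (proj j L)) (fst_nat (snd_nat (proj j L)))
    (snd_nat (snd_nat (proj j L))).

Lemma coded_derivationP u e x y : eval (finset_of u) (decode e) x y <->
  exists L, exists n, coded_derivation u L n /\
    exists i, i < n /\ proj i L = pair_nat e (pair_nat x y).
Proof.
split=> [/derivable_eval[l D]|[L [n [D [i [iL E]]]]]].
  rewrite decodeK => /(_ _ (mem_head _ _)) tl.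
  have [L HL] := proj_surj (size l) (nth 0 l); exists L, (size l); split; last first.
    exists (index (pair_nat e (pair_nat x y)) l).
    by rewrite HL index_mem tl nth_index.
  move=> j jl; rewrite HL jl.
  have : justified u (mem_fact (drop j.+1 l)) (fst_nat (nth 0 l j))
      (fst_nat (snd_nat (nth 0 l j))) (snd_nat (snd_nat (nth 0 l j))).
    elim: l j jl D {tl L HL} => // t l IH [|j] /= jl [J D]; first by rewrite drop0.
    exact: IH.
  apply: justified_mono => e' x' y' /(nthP 0)[k]; rewrite size_drop nth_drop => kl E.
  rewrite ltn_subRL in kl; exists (j.+1 + k); rewrite HL kl; split=> //; split=> //; lia.
(* Induction on the distance to the end, since premises stand at later positions. *)
suff: forall m j, n - j <= m -> j < n -> eval (finset_of u)
    (decode (fst_nat (proj j L))) (fst_nat (snd_nat (proj j L))) (snd_nat (snd_nat (proj j L))).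
  by move/(_ _ _ (leqnn _) iL); rewrite E !(pair_natK1, pair_natK2).
elim=> [|m IH] j jm jn; first by lia.
apply: (justified_sound _ (D j jn)) => e' x' y' [k [[jk kn] Ek]].
by have := IH k; rewrite Ek !(pair_natK1, pair_natK2); apply; lia.
Qed.

(** The universal machine: derivations are finite, and their steps can be verified uniformly in the
    oracle code [U z] and the index [E z]. *)
Lemma semirec_eval A U E S T :
  recursive_in A U -> recursive_in A E -> recursive_in A S -> recursive_in A T ->
  semirec A (fun z => eval (finset_of (U z)) (decode (E z)) (S z) (T z)).
Proof.
move=> RU RE RS RT.
apply: (@semirec_iff _ (fun z => exists L, exists n, coded_derivation (U z) L n /\
    exists i, i < n /\ proj i L = pair_nat (E z) (pair_nat (S z) (T z)))).
  by move=> z; rewrite coded_derivationP.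
rewrite /coded_derivation /justified /coded_fact; semi.
Qed.

Lemma finset_of0 : finset_of 0 = set0.
Proof. by apply/funext => x; apply/propext; rewrite /finset_of proj_ge. Qed.

Lemma semirec_Phi0 A E S T :
  recursive_in A E -> recursive_in A S -> recursive_in A T ->
  semirec A (fun z => Phi (E z) set0 (S z) (T z)).
Proof.
by move=> RE RS RT; rewrite -finset_of0; apply: semirec_eval => //; recur.
Qed.

(** * Diagonal vectors and compactness *)

Definition diagonal_vector (d s w : nat) : Prop :=
  forall j, j < d -> Phi (proj j s) set0 (proj j s) (proj j w).

(** Nonuniform reduction, as in Jockusch's theorem on bounded DNC functions:
    either some fixed head makes the tails miss the diagonal, or for every head
    some tail is found on the diagonal, and then the head value misses it. *)
Lemma PA_degree_vectors d A (P : nat -> nat -> Prop) :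
  semirec A (fun z => P (fst_nat z) (snd_nat z)) -> (forall s, exists w, P s w) ->
  (forall s w, P s w -> (forall j, j < d -> proj j w < 2) /\ ~ diagonal_vector d s w) ->
  PA_degree A.
Proof.
elim: d P => [|d IH] P SP EP HP.
  by have [w /HP[_ []]] := EP 0.
have [[n Hn]|Hn] := pselect (exists n, forall s w v,
    P (pair_nat n s) (pair_nat v w) -> ~ diagonal_vector d s w).
  apply: (IH (fun s w => exists v, P (pair_nat n s) (pair_nat v w))).
  - apply: semirec_ex; apply: (@semirec_iff _ (fun z =>
      (fun t => P (fst_nat t) (snd_nat t)) (pair_nat (pair_nat n (fst_nat (fst_nat z)))
        (pair_nat (snd_nat z) (snd_nat (fst_nat z)))))).
      by move=> z; rewrite !(pair_natK1, pair_natK2).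
    by apply: semirec_comp SP; recur.
  - move=> s; have [w Hw] := EP (pair_nat n s).
    by exists (snd_nat w), (fst_nat w); rewrite pair_natE.
  - move=> s w [v Hv]; split; last exact: Hn Hv.
    by move=> j jd; have [/(_ j.+1 jd)] := HP _ _ Hv; rewrite proj_pairS.
apply: (@semirec_PA_degree _ (fun z => exists s, exists w,
    P (pair_nat (fst_nat z) s) (pair_nat (snd_nat z) w) /\
    forall j, j < d -> Phi (proj j s) set0 (proj j s) (proj j w))).
- apply/semirec_ex/semirec_ex/semirec_and; last first.
    apply: semirec_ball; first by recur.
    by apply: semirec_Phi0; recur.
  apply: (@semirec_iff _ (fun z => (fun t => P (fst_nat t) (snd_nat t))
      (pair_nat (pair_nat (fst_nat (fst_nat (fst_nat z))) (snd_nat (fst_nat z)))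
        (pair_nat (snd_nat (fst_nat (fst_nat z))) (snd_nat z))))).
    by move=> z; rewrite !(pair_natK1, pair_natK2).
  by apply: semirec_comp SP; recur.
- move=> n; apply: contrapT => H; apply: Hn; exists n => s w v Hv Hd; apply: H.
  by exists v, s, w; rewrite pair_natK1 pair_natK2.
- move=> n v [s [w]]; rewrite pair_natK1 pair_natK2 => -[Hv Hd].
  have [/(_ 0 isT)] := HP _ _ Hv; rewrite proj_pair0 => v2 H; split=> // Pv; apply: H.
  by case=> [|j] jd; rewrite ?proj_pair0 ?proj_pairS //; apply: Hd.
Qed.

(** Koenig's lemma: values at [0], [1], ... are chosen in turn, each taken by infinitely many of the
    remaining [l]. *)
Lemma bounded_limit K (c : nat -> nat -> nat) : (forall l x, x < l -> c l x < K) ->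
  exists2 c', forall x, c' x < K & forall m, exists2 l, m <= l & forall x, x < m -> c l x = c' x.
Proof.
move=> cK.
pose frequently (P : nat -> Prop) := forall m, exists2 l, m <= l & P l.
have pigeon x P : frequently P ->
    exists k, k < K /\ frequently (fun l => P l /\ c l x = k).
  move=> FP; apply: contrapT => N.
  (* If no value below [K] is frequent, excluding them one by one pushes [c l x] up to [K] for all
     late [l] in [P]. *)
  have: exists m, forall l, m <= l -> P l -> K <= c l x.
    elim: {-2}K (leqnn K) => [|k IH] kK; first by exists 0.
    have [|m Hm] := IH; first by lia.
    have : ~ frequently (fun l => P l /\ c l x = k) by move=> F; apply: N; exists k.
    move=> /existsNP[m' Hm']; exists (m + m') => l ml Pl.
    rewrite ltn_neqAle Hm ?andbT //; last by lia.
    by apply/negP => /eqP E; apply: Hm'; exists l => //; lia.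
  move=> [m Hm]; have [l ml Pl] := FP (m + x.+1).
  have [xl mle] : x < l /\ m <= l by split; lia.
  by have := Hm l mle Pl; have := cK l x xl; lia.
have /choice[g Hg] : forall t : nat * (nat -> Prop), exists k, frequently t.2 ->
    k < K /\ frequently (fun l => t.2 l /\ c l t.1 = k).
  move=> [x P]; have [F|] := pselect (frequently P); last by exists 0.
  by have [k Hk] := pigeon x P F; exists k.
(* [S x] holds of the [l] that follow the choices made at all [y < x]. *)
pose S := fix S x := if x is y.+1 then fun l => S y l /\ c l y = g (y, S y) else fun=> True.
have FS x : frequently (S x).
  elim: x => [|x IH]; first by move=> m; exists m.
  by have [] := Hg (x, S x) IH.
exists (fun x => g (x, S x)) => [x|m]; first by have [] := Hg (x, S x) (FS x).
have [l ml Sl] := FS m m; exists l => // {ml}.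
by elim: m Sl => // m IH [/IH Sl E] x; rewrite ltnS leq_eqVlt => /orP[/eqP->|/Sl].
Qed.

(** Membership of a coded finite set in the Mathias condition with stem [F], frozen up to [b], and
    reservoir [Y]. *)
Definition extends (b F : nat) (Y : set nat) (w : nat) : Prop :=
  (forall x, x < b.+1 -> proj x w = proj x F) /\
  (forall x, b < x -> proj x w = 0 \/ Y x).

Lemma extends_sub b F (Y Z : set nat) w :
  (forall x, b < x -> Y x -> Z x) -> extends b F Y w -> extends b F Z w.
Proof. by move=> YZ [E H]; split=> // x bx; case: (H x bx) => [|/YZ]; [left | right; auto]. Qed.

Lemma extends_refl b F Y : (forall x, b < x -> proj x F = 0) -> extends b F Y F.
Proof. by move=> F0; split=> // x /F0; left. Qed.

Lemma extends_trans b b' F Y w w' : b <= b' ->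
  extends b F Y w -> extends b' w Y w' -> extends b F Y w'.
Proof.
move=> bb [E H] [E' H']; split=> [x xb|x bx]; first by rewrite E' ?E //; lia.
by have [xb'|b'x] := ltnP x b'.+1; [rewrite E' //; exact: H | exact: H'].
Qed.

Definition color_class (T : Type) (X : set nat) (c : nat -> T) (k : T) : set nat :=
  fun x => X x /\ c x = k.

Lemma semirec_uncolorable (X : set nat) b K (I : finType)
    (k : I -> 'I_K) (F : I -> nat) (P : I -> nat -> nat -> Prop) :
  (forall i, semirec X (fun z => P i (fst_nat z) (snd_nat z))) ->
  semirec X (fun z => ~ exists c : nat -> 'I_K,
    forall i w, extends b (F i) (color_class X c (k i)) w -> ~ P i z w).
Proof.
move=> SP.
(* By compactness a failure for all colorings is already visible on some
   initial segment [x < l], where colorings are coded by numbers [u]. *)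
pose bad i z l u := exists w, (forall x, x < b.+1 -> proj x w = proj x (F i)) /\
  (* Positions from [w] on carry [0], so a bounded quantifier is enough. *)
  (forall x, x < w -> x < b.+1 \/ (proj x w = 0 \/ (x < l /\ X x /\ proj x u = k i))) /\
  P i z w.
apply: (@semirec_iff _ (fun z => exists l, forall u, u < (seq_bound K l).+1 ->
    (* Codes with a value of at least [K] are not colorings and are passed over. *)
    (exists x, x < l /\ exists y, proj x u = K + y) \/
    (exists2 i, i \in enum I & bad i z l u))).
  move=> z; split=> [[l Hl] [c Hc]|N].
    have [|u ub Hu] := @proj_surj_bound K l (fun x => c x); first by move=> *; apply: ltn_ord.
    have [|[x [xl [y]]]|[i _ [w [w1 [w2 ew]]]]] := Hl u; first by rewrite ltnS.
      by rewrite Hu // => E; have := ltn_ord (c x); lia.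
    apply: (Hc i w) => //; split=> // x bx.
    have [xw|wx] := ltnP x w; last by left; rewrite proj_ge.
    have [|[->|[xl [Xx Ex]]]] := w2 x xw; [lia | by left | right].
    by split=> //; apply: ord_inj; rewrite -Ex Hu.
  apply: contrapT => /forallNP H; apply: N.
  have /choice[u Hu] : forall l, exists u, (forall x, x < l -> proj x u < K) /\
      forall i, ~ bad i z l u.
    move=> l; have /existsNP[u /not_implyP[_ /not_orP[N1 N2]]] := H l; exists u; split.
      move=> x xl; rewrite ltnNge; apply/negP => Kx; apply: N1; exists x; split=> //.
      by exists (proj x u - K); lia.
    by move=> i B; apply: N2; exists i; rewrite ?mem_enum.
  have [|c cK Hc] := @bounded_limit K (fun l x => proj x (u l)).
    by move=> l; have [] := Hu l.
  (* A violation by [w] concerns only colors below [w], where the limit agrees with a good coloring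
     of a segment of length at least [w]. *)
  exists (fun x => Ordinal (cK x)) => i w [w1 w2] ew; have [l wl El] := Hc w.
  have [_ /(_ i)] := Hu l; apply; exists w; split=> //; split=> // x xw.
  have [xb|bx] := ltnP x b.+1; [by left | right].
  have [->|[Xx Ex]] := w2 x bx; [by left | right].
  by rewrite (leq_trans xw) // El // -Ex.
apply: semirec_ex; apply: semirec_ball; first by recur.
apply: semirec_or; first by semi.
apply: semirec_has => i _.
rewrite /bad /=; apply: semirec_ex; apply: semirec_and; first by semi.
apply: semirec_and; first by semi.
pose Q t := P i (fst_nat t) (snd_nat t).
apply: (@semirec_iff _ (fun z => Q (pair_nat (fst_nat (fst_nat (fst_nat z))) (snd_nat z)))).
  by move=> z; rewrite /Q pair_natK1 pair_natK2.
by apply: semirec_comp; [recur | exact: SP].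
Qed.

(** * Attempts and their limits *)

(** One step of the multiset order, on lists. *)
Inductive replace_one (T : Type) (lt : T -> T -> Prop) : seq T -> seq T -> Prop :=
  | replace_head x ys r : (forall y, List.In y ys -> lt y x) ->
      replace_one lt (ys ++ r) (x :: r)
  | replace_tail x r r' : replace_one lt r' r -> replace_one lt (x :: r') (x :: r).

(** Consing onto an accessible list preserves accessibility, by induction on the head and then on
    the tail: when [ys] replaces the head, its smaller entries are consed one at a time. *)
Lemma Acc_replace_one (T : Type) (lt : T -> T -> Prop) S :
  (forall x, Acc lt x) -> Acc (replace_one lt) S.
Proof.
move=> Alt; elim: S => [|x S]; first by constructor=> S' H; inversion H.
elim: {x}(Alt x) S => x _ IHx S AS; elim: AS (AS) => {}S _ IHS AS.
constructor=> S' H; inversion H as [x' ys r Hys E1 [E2 E3]|x' r r' Hr E1 [E2 E3]]; subst.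
  elim: ys Hys {H} => [|y ys IHys] Hys; first exact: AS.
  apply: (IHx y); first by apply: Hys; left.
  by apply: IHys => z zs; apply: Hys; right.
by apply: (IHS r' Hr); case: AS => AS; apply: AS.
Qed.

(** A simultaneous replacement is a chain of single ones, nonempty because one entry does change. *)
Lemma replace_many (T : Type) (lt : T -> T -> Prop) (I : eqType) (r : seq I)
    (t : I -> T) (g : I -> seq T) :
  (forall i, i \in r -> g i = [:: t i] \/ forall y, List.In y (g i) -> lt y (t i)) ->
  (exists2 i, i \in r & forall y, List.In y (g i) -> lt y (t i)) ->
  clos_trans _ (replace_one lt) (flatten (map g r)) (map t r).
Proof.
set strict := fun i => forall y, List.In y (g i) -> lt y (t i).
have tail x S' S : clos_trans _ (replace_one lt) S' S ->
    clos_trans _ (replace_one lt) (x :: S') (x :: S).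
  elim=> {S S'} [S' S H|S1 S2 S3 _ H1 _ H2]; first by apply: t_step; apply: replace_tail.
  exact: t_trans H1 H2.
elim: r => [|i r IH] Hg [k] //.
have Hr j : j \in r -> g j = [:: t j] \/ strict j.
  by move=> jr; apply: Hg; rewrite inE jr orbT.
move=> kr Sk; have [[j jr Sj]|N] := pselect (exists2 j, j \in r & strict j).
  have {}IH := tail (t i) _ _ (IH Hr (ex_intro2 _ _ j jr Sj)).
  have [E|Si] := Hg i (mem_head _ _); first by rewrite /= E.
  by apply: t_trans IH; apply: t_step; apply: replace_head.
have Er : flatten (map g r) = map t r.
  elim: r Hr N {IH Hg kr} => //= j r IH Hr N.
  have [E|Sj] := Hr j (mem_head _ _); last by case: N; exists j; rewrite ?mem_head.
  rewrite E /= IH // => [l lr|[l lr Sl]]; first by apply: Hr; rewrite inE lr orbT.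
  by apply: N; exists l => //; rewrite inE lr orbT.
move: kr Sk; rewrite inE => /orP[/eqP->|kr] Sk; last by case: N; exists k.
by rewrite /= Er; apply: t_step; apply: replace_head.
Qed.

Definition unbounded (G : set nat) : Prop := forall b, exists x, b < x /\ G x.

(** Below, a stem [F] with bound [b] stands for all sets that agree with [F]
    up to [b]. *)
Definition hits_diagonal (e F b : nat) : Prop :=
  exists n v, Phi n set0 n v /\
    forall B : set nat, (forall i, i < b.+1 -> (B i <-> finset_of F i)) -> eval B (decode e) n v.

Lemma hits_diagonal_mono e F b F' b' : b <= b' ->
  (forall x, x < b.+1 -> proj x F' = proj x F) ->
  hits_diagonal e F b -> hits_diagonal e F' b'.
Proof.
move=> bb E [n [v [Pv H]]]; exists n, v; split=> // B HB; apply: H => i ib.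
by rewrite HB /finset_of ?E //; lia.
Qed.

(** The limit set reads [x] off stage [x], where it is already frozen since [x <= b x]. *)
Lemma limit_set_agree (F b : nat -> nat) :
  (forall t, b t < b t.+1) ->
  (forall t x, x < (b t).+1 -> proj x (F t.+1) = proj x (F t)) ->
  forall t x, x < (b t).+1 -> (finset_of (F x) x <-> finset_of (F t) x).
Proof.
move=> bS FS.
have bge t : t <= b t by elim: t => // t IH; have := bS t; lia.
have bmono s k : b s <= b (s + k).
  by elim: k => [|k IH]; rewrite ?addn0 // addnS; have := bS (s + k); lia.
have Fmono s k x : x < (b s).+1 -> proj x (F (s + k)) = proj x (F s).
  move=> xs; elim: k => [|k IH]; first by rewrite addn0.
  by rewrite addnS FS //; have := bmono s k; lia.
move=> t x xt; rewrite /finset_of; have [tx|/ltnW tx] := leqP t x.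
  by rewrite -(subnKC tx) Fmono // subnKC.
by rewrite -(subnKC tx) Fmono // ltnS.
Qed.

(** A hit persists to the limit and makes the computed function meet the diagonal; in the other
    case, a bit output at [n] would by the use principle already appear at a late stem. *)
Lemma limit_not_PA (F b : nat -> nat) :
  (forall t, b t < b t.+1) ->
  (forall t x, x < (b t).+1 -> proj x (F t.+1) = proj x (F t)) ->
  (forall e, exists t, hits_diagonal e (F t) (b t) \/ exists n, forall s v, t <= s ->
    v < 2 -> ~ eval (finset_of (F s)) (decode e) n v) ->
  ~ PA_degree (fun x => finset_of (F x) x).
Proof.
move=> bS FS HF [f [PAf [e He]]]; have Ag := limit_set_agree bS FS.
have [t [[n [v [Pv /(_ _ (Ag t)) Ev]]]|[n Hn]]] := HF e.
  by apply: PAf Pv _; apply: eval_inj (He n) Ev.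
have [u Hu] := eval_use (He n).
have bge s : s <= b s by elim: s => // s IH; have := bS s; lia.
apply: (Hn (u + t) (nat_of_bool (f n))); [lia | by case: (f n) |].
by apply: Hu => i iu; apply: Ag; have := bge (u + t); lia.
Qed.

(** An attempt at building a subset of [Y] of non-PA degree: in an even
    phase the stem waits for a new element, in an odd phase [2 e + 1] for
    the [e]-th requirement. A pair [(e, n)] in [avoid] promises that the
    [e]-th functional takes no value below [2] at [n]. *)
Record attempt := Attempt {
  stem : nat; bound : nat; phase : nat; avoid : seq (nat * nat) }.

Definition no_bit (e n w : nat) : Prop :=
  forall v, v < 2 -> ~ eval (finset_of w) (decode e) n v.

(** [e < (phase s)./2] says that phase [2 e + 1], the one for requirement [e], is over. *)
Definition valid_attempt (Y : set nat) (s : attempt) : Prop :=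
  [/\ forall x, finset_of (stem s) x -> Y x,
      forall x, bound s < x -> proj x (stem s) = 0,
      forall e, e < (phase s)./2 -> hits_diagonal e (stem s) (bound s) \/
        exists n, (e, n) \in avoid s
    & forall p, p \in avoid s -> no_bit p.1 p.2 (stem s)].

Definition next_attempt (Y : set nat) (s' s : attempt) : Prop :=
  valid_attempt Y s' /\
  [/\ bound s < bound s',
      forall x, x < (bound s).+1 -> proj x (stem s') = proj x (stem s),
      {subset avoid s <= avoid s'},
      phase s' = (phase s).+1
    & ~~ odd (phase s) -> exists x, [/\ bound s < x, x <= bound s' & proj x (stem s') = 1]].

(** An infinite descent has a limit inside [Y], unbounded by the even phases and of non-PA degree by
    the odd ones. *)
Lemma Acc_next_attempt (Y : set nat) :
  (forall G : set nat, (forall x, G x -> Y x) -> unbounded G -> PA_degree G) ->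
  forall s, Acc (next_attempt Y) s.
Proof.
move=> HY s; apply: contrapT => Ns.
have /choice[g Hg] : forall s, exists s', ~ Acc (next_attempt Y) s ->
    next_attempt Y s' s /\ ~ Acc (next_attempt Y) s'.
  move=> {Ns}s; have [As|Ns] := pselect (Acc (next_attempt Y) s); first by exists s.
  apply: contrapT => /forallNP H; apply: Ns; constructor=> s' s's.
  by apply: contrapT => Ns'; apply: (H s').
(* [s] itself may be invalid, so the chain starts at its successor. *)
pose a t := iter t.+1 g s.
have Na t : ~ Acc (next_attempt Y) (iter t g s).
  by elim: t => //= t /Hg[].
have aS t : next_attempt Y (a t.+1) (a t) by have [] := Hg _ (Na t.+1).
have aV t : valid_attempt Y (a t) by have [[]] := Hg _ (Na t).
have bS t : bound (a t) < bound (a t.+1) by have [_ []] := aS t.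
have FS t x : x < (bound (a t)).+1 -> proj x (stem (a t.+1)) = proj x (stem (a t)).
  by have [_ [_ H _ _ _]] := aS t; apply: H.
have bge t : t <= bound (a t) by elim: t => // t IH; have := bS t; lia.
have pa t : phase (a t) = phase (a 0) + t.
  elim: t => [|t IH]; first by rewrite addn0.
  by have [_ [_ _ _ -> _]] := aS t; rewrite IH addnS.
have Ag := limit_set_agree bS FS.
apply: (limit_not_PA bS FS); last first.
  apply: HY => [x|b]; first by have [H _ _ _] := aV x; apply: H.
  have [t bt pt] : exists2 t, b <= t & ~~ odd (phase (a t)).
    (* The parity correction makes the phase even. *)
    exists (b + odd (phase (a 0) + b)); first by lia.
    by rewrite pa addnA oddD; case: (odd (_ + b)).
  have [_ [_ _ _ _ /(_ pt)[x [bx xb px]]]] := aS t; exists x.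
  by split; [have := bge t; lia | apply/(Ag t.+1)].
(* By stage [2 e + 2] the phase is past [2 e + 1], whatever it was at the start. *)
move=> e; exists (e.+1.*2); have [_ _ /(_ e) H _] := aV (e.+1.*2).
have [|?|[n Hn]] := H; [by rewrite pa; lia | by left | right].
exists n => t v et; have [k ->] : exists k, t = e.+1.*2 + k by exists (t - e.+1.*2); lia.
have: (e, n) \in avoid (a (e.+1.*2 + k)).
  elim: k => [|k IH]; first by rewrite addn0.
  by rewrite addnS; have [_ [_ _ Hs _ _]] := aS (e.+1.*2 + k); apply: Hs.
by have [_ _ _ Hv] := aV (e.+1.*2 + k); move/Hv; apply.
Qed.

(** * Liu's theorem *)

(** A task attempts both halves [Y true] and [Y false] at once. *)
Definition task : Type := bool -> attempt.

Definition update (t : task) (a : bool) (s : attempt) : task :=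
  fun a' => if a' == a then s else t a'.

Definition next_task (Y : bool -> set nat) (t' t : task) : Prop :=
  exists a s, next_attempt (Y a) s (t a) /\ t' = update t a s.

Lemma Acc_next_task (Y : bool -> set nat) :
  (forall a s, Acc (next_attempt (Y a)) s) -> forall t, Acc (next_task Y) t.
Proof.
move=> AY t.
suff H s1 : Acc (next_attempt (Y true)) s1 -> forall s0, Acc (next_attempt (Y false)) s0 ->
    forall t, t true = s1 -> t false = s0 -> Acc (next_task Y) t by exact: H.
elim=> {}s1 _ IH1 s0 A0; elim: (A0) => {A0}s0 H0 IH0 {}t E1 E0.
constructor=> _ [[] [s [Hs ->]]].
  by apply: (IH1 s _ s0) => //; rewrite -E1.
by apply: (IH0 s) => //; rewrite -E0.
Qed.

Definition respects (T : Type) (X : set nat) (B : nat) (c : nat -> T) (i : T) (s : attempt) : Prop :=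
  forall p, p \in avoid s -> forall w, extends B (stem s) (color_class X c i) w ->
    no_bit p.1 p.2 w.

Definition admissible (X : set nat) (Y : bool -> set nat) (I : eqType) (r : seq I)
    (t : I -> task) (c : nat -> I) (B : nat) : Prop :=
  (forall x, c x \in r) /\ forall i, i \in r -> forall a,
    [/\ valid_attempt (Y a) (t i a), bound (t i a) <= B & respects X B c i (t i a)].

Definition extendible (X : set nat) (Y : bool -> set nat) (S : seq task) : Prop :=
  exists (I : eqType) (r : seq I) (t : I -> task) (c : nat -> I) (B : nat),
    S = map t r /\ admissible X Y r t c B.

Definition smaller (Y : bool -> set nat) : seq task -> seq task -> Prop :=
  clos_trans _ (replace_one (next_task Y)).

Lemma admissible_weaken (X : set nat) (Y : bool -> set nat) (I : eqType) (r : seq I) t c B b' i a Z w :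
  admissible X Y r t c B -> i \in r -> B <= b' ->
  extends b' (stem (t i a)) Z w -> extends B (stem (t i a)) Z w.
Proof.
move=> [_ H] ir Bb; apply: extends_trans => //; apply: extends_refl => x Bx.
by have [[_ F0 _ _] bB _] := H i ir a; apply: F0; lia.
Qed.

(** A single attempt moves to the stem [w] and the coloring stays. Promises survive because
    extensions of [w] in the class also extend the old stem. *)
Lemma extendible_update (X : set nat) (Y : bool -> set nat) (I : eqType) (r : seq I) t c B i a w b' :
  (forall x a, Y a x -> X x) -> admissible X Y r t c B -> i \in r ->
  extends B (stem (t i a)) (color_class (Y a) c i) w -> B < b' -> w <= b' ->
  (odd (phase (t i a)) -> hits_diagonal (phase (t i a))./2 w b') ->
  (~~ odd (phase (t i a)) ->
    exists x, [/\ bound (t i a) < x, x <= b' & proj x w = 1]) ->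
  exists2 S, extendible X Y S & smaller Y S (map t r).
Proof.
move=> YX adm ir wE Bb wb Hodd Heven; have [cr H] := adm.
have wE' : extends B (stem (t i a)) (color_class X c i) w.
  by apply: extends_sub wE => x _ [Yx Ex]; split=> //; apply: YX Yx.
have [[VY V0 Vh Va] bB Hr] := H i ir a.
pose s := Attempt w b' (phase (t i a)).+1 (avoid (t i a)).
have agr x : x < (bound (t i a)).+1 -> proj x w = proj x (stem (t i a)).
  by move=> xb; case: wE => E _; apply: E; lia.
have Vs : valid_attempt (Y a) s.
  split=> //=.
  - move=> x; case: wE => E HY; rewrite /finset_of.
    have [xB|Bx] := ltnP x B.+1; first by rewrite E //; apply: VY.
    by case: (HY x Bx) => [->|[]].
  - by move=> x bx; apply: proj_ge; lia.
  - move=> e; rewrite uphalf_half; case O: (odd _) Hodd => Hodd /= He; last first.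
      by have [h|] := Vh e He; [left; apply: hits_diagonal_mono h => //; lia | right].
    have [->|eN] := eqVneq e (phase (t i a))./2; first by left; apply: Hodd.
    have [|h|] := Vh e; [lia | left | by right].
    by apply: hits_diagonal_mono h => //; lia.
  - by move=> p /Hr; apply.
have next : next_attempt (Y a) s (t i a) by split=> //; split=> //=; lia.
pose t' j := if j == i then update (t i) a s else t j.
exists (map t' r); last first.
  rewrite -flatten_map1; apply: replace_many.
    move=> j jr; rewrite /t'; case: eqP => [->|_]; [right | by left].
    by move=> y [<-|//]; exists a, s.
  by exists i => // y; rewrite /t' eqxx => -[<-|//]; exists a, s.
exists I, r, t', c, b'; split=> //; split=> // j jr a'.
have [V bj R] := H j jr a'.
have other : [/\ valid_attempt (Y a') (t j a'), bound (t j a') <= b' & respects X b' c j (t j a')].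
  split=> //; first by lia.
  by move=> p /R{}R v vE; apply: R; apply: (admissible_weaken adm jr (ltnW Bb) vE).
rewrite /t'; case: eqP => [Ej|//]; rewrite /update; case: eqP => [->|_]; last by rewrite -Ej.
split=> // p /= /Hr{}Hr v vE; apply: Hr; rewrite Ej in vE.
by apply: extends_trans vE => //; lia.
Qed.

Lemma extendible_step (X : set nat) (Y : bool -> set nat) S :
  unbounded X -> ~ PA_degree X -> (forall x a, Y a x -> X x) ->
  (forall x, X x -> exists a, Y a x) -> extendible X Y S ->
  exists2 S', extendible X Y S' & smaller Y S' S.
Proof.
move=> uX nX YX XY [I [r [t [c [B [-> adm]]]]]].
have [cr H] := adm.
(* First case: an attempt in an even phase finds a new element [x] in its class and half. *)
have [[i [a [x [ir [ev Bx Yx cx]]]]]|N] := pselect (exists i a x,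
    i \in r /\ [/\ ~~ odd (phase (t i a)), B < x, Y a x & c x = i]).
  have [w Hw] := proj_surj x.+1 (fun y => if y < B.+1 then proj y (stem (t i a)) else y == x).
  have [_ bB _] := H i ir a.
  apply: (@extendible_update X Y I r t c B i a w (B + w + x).+1) => //; try lia.
  - split=> y By; rewrite Hw; first by rewrite By ifT //; lia.
    have -> : (y < B.+1) = false by lia.
    by have [->|_] := eqVneq y x; [right | left; rewrite if_same].
  - move=> _; exists x; split; [lia | lia | rewrite Hw ltnSn eqxx].
    by have -> : (x < B.+1) = false by lia.
(* The new colors: pairs of an old class and a half whose attempt is in an odd phase. By [N], the
   other pairs contain no point beyond [B]. *)
pose M := [seq ia <- [seq (i, a) | i <- r, a <- [:: true; false]] | odd (phase (t ia.1 ia.2))].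
pose K := size M.
pose m (k : 'I_K) := tnth (in_tuple M) k.
have mP k : (m k).1 \in r /\ odd (phase (t (m k).1 (m k).2)).
  have : m k \in M by apply: mem_tnth.
  by rewrite mem_filter => /andP[od /allpairsP[[i a] /= [ir _ Em]]]; split=> //; rewrite Em.
have cover x : B < x -> X x -> exists k, (m k).1 = c x /\ Y (m k).2 x.
  move=> Bx /XY[a Yx].
  have cM : (c x, a) \in M.
    rewrite mem_filter; apply/andP; split; last by apply: allpairs_f => //; case: (a).
    by apply: contrapT => /negP od; apply: N; exists (c x), a, x.
  have /tnthP[k Ek] : (c x, a) \in in_tuple M by [].
  by exists k; rewrite /m -Ek.
(* Either [w] breaks a promise of one of the two attempts carried by color [q.1], or the attempt
   designated by that color gives some bit of the vector coded in [z]. *)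
pose P (q : 'I_K * bool) z w :=
  (exists2 p, p \in avoid (t (m q.1).1 q.2) &
    exists v, v < 2 /\ eval (finset_of w) (decode p.1) p.2 v) \/
  (q.2 = (m q.1).2 /\ exists j, j < K /\
    eval (finset_of w) (decode (phase (t (m q.1).1 q.2))./2)
      (proj j (fst_nat z)) (proj j (snd_nat z))).
(* Classes are taken in [X] and not in a half: the halves have arbitrary complexity, and failure
   must be semirecursive in [X]. *)
pose colorable z := exists d : nat -> 'I_K, forall q w,
  extends B (stem (t (m q.1).1 q.2)) (color_class X d q.1) w -> ~ P q z w.
have SW : semirec X (fun z => ~ colorable z).
  apply: semirec_uncolorable => q; apply: semirec_or.
    apply: semirec_has => p _; apply: semirec_ex; apply: semirec_and; first by semi.
    by apply: semirec_eval; recur.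
  apply: semirec_and; first by semi.
  apply: semirec_ex; apply: semirec_and; first by semi.
  by apply: semirec_eval; recur.
have [[s [v [sv ncol]]]|noW] := pselect (exists s v, diagonal_vector K s v /\
    ~ colorable (pair_nat s v)).
  (* The coloring induced by the true halves fails, so some stem can hit the
     diagonal inside its half. *)
  have [k0 _] : exists k : 'I_K, True.
    by have [x [/cover Hx /Hx[k _]]] := uX B; exists k.
  have /choice[d Hd] : forall x, exists k, B < x -> X x -> (m k).1 = c x /\ Y (m k).2 x.
    move=> x; have [[Bx Xx]|n] := pselect (B < x /\ X x); last by exists k0 => *; case: n.
    by have [k Hk] := cover x Bx Xx; exists k.
  have dsub k x : B < x -> color_class X d k x -> color_class (Y (m k).2) c (m k).1 x.
    by move=> Bx [Xx <-]; have [-> Yx] := Hd x Bx Xx.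
  move/forallNP/(_ d)/existsNP: ncol => [q /existsNP[w /not_implyP[wE /contrapT Pq]]].
  have [mr mo] := mP q.1.
  case: Pq => [[p pa [u [u2 ev]]]|[E [j [jK ev]]]].
    have [_ _ R] := H _ mr q.2; case: (R p pa w _ u u2 ev).
    by apply: extends_sub wE => x Bx /(dsub _ _ Bx)[Yx Ex]; split=> //; apply: YX Yx.
  have [u Hu] := eval_use ev; rewrite E in wE ev Hu.
  apply: (@extendible_update X Y I r t c B (m q.1).1 (m q.1).2 w (B + w + u).+1) => //; try lia.
  - by apply: extends_sub wE => x; apply: dsub.
  - move=> _; exists (proj j s), (proj j v); split; first exact: sv.
    by rewrite !(pair_natK1, pair_natK2) in Hu => D HD; apply: Hu => i iu; rewrite HD //; lia.
(* Otherwise the uncolorable vectors, none of them on the diagonal, would give [X] PA degree. *)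
have [s Hs] : exists s, forall v, (forall j, j < K -> proj j v < 2) -> colorable (pair_nat s v).
  apply: contrapT => /forallNP Ns; apply: nX.
  apply: (@PA_degree_vectors K X (fun s v =>
      (forall j, j < K -> proj j v < 2) /\ ~ colorable (pair_nat s v))).
  - apply: semirec_and; first by semi.
    by apply: (@semirec_iff _ (fun z => ~ colorable z)) => // z; rewrite pair_natE.
  - by move=> s; have /existsNP[v /not_implyP[? ?]] := Ns s; exists v.
  - by move=> s v [v2 nc]; split=> // sv; apply: noW; exists s, v.
pose V := {ffun 'I_K -> bool}.
have /choice[d Hd] : forall f : V, exists d : nat -> 'I_K, forall q w,
    extends B (stem (t (m q.1).1 q.2)) (color_class X d q.1) w ->
    (forall p, p \in avoid (t (m q.1).1 q.2) -> no_bit p.1 p.2 w) /\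
    (q.2 = (m q.1).2 -> forall j : 'I_K, ~ eval (finset_of w)
      (decode (phase (t (m q.1).1 q.2))./2) (proj j s) (f j)).
  move=> f; have [v Hv] := proj_surj K (fun j => oapp f false (insub j)).
  have vE (j : 'I_K) : proj j v = f j by rewrite Hv ltn_ord insubT //= => ?; congr (nat_of_bool (f _)); apply: val_inj.
  have [|d Hd] := Hs v; first by move=> j jK; rewrite Hv jK; case: (oapp _ _ _).
  exists d => q w wE; split=> [p pa u u2 ev|E j ev]; apply: (Hd q w wE); [left | right].
    by exists p => //; exists u.
  by split=> //; exists j; rewrite pair_natK1 pair_natK2 vE.
(* Pigeonhole: there are [2 ^ K] vectors and only [K] colors. *)
have /choice[g Hg] : forall x, exists q : V * V, q.1 != q.2 /\ d q.1 x = d q.2 x.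
  move=> x; apply: contrapT => /forallNP Hn.
  have /leq_card : injective (fun f => d f x).
    move=> f f' E; apply/eqP; apply: contrapT => /negP ff'; exact: (Hn (f, f')).
  by rewrite card_ffun card_bool card_ord leqNgt ltn_expl.
(* A coordinate where the two vectors differ; [d q.1 0] is a mere inhabitant for equal ones. *)
have /choice[pos Hpos] : forall q : V * V, exists j : 'I_K, q.1 != q.2 -> q.1 j != q.2 j.
  move=> q; have [E|n] := eqVneq q.1 q.2; first by exists (d q.1 0).
  apply: contrapT => /forallNP Hn; case/negP: n; apply/eqP/ffunP => j.
  by apply/eqP; apply: contrapT => /negP nj; apply: (Hn j) => _.
(* A refined class records the old class, the shared color and the two vectors sharing it. *)
pose J : eqType := (I * ('I_K * (V * V)))%type.
pose Q i := [seq kq <- enum {: 'I_K * (V * V)} | ((m kq.1).1 == i) && (kq.2.1 != kq.2.2)].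
pose r' := [seq (i, kq) | i <- r, kq <- Q i].
pose next (s0 : attempt) j :=
  Attempt (stem s0) B.+1 (phase s0).+1 (((phase s0)./2, proj j s) :: avoid s0).
pose t' (y : J) : task := let k := y.2.1 in
  update (t y.1) (m k).2 (next (t y.1 (m k).2) (pos y.2.2)).
pose c' x : J := let k := d (g x).1 x in ((m k).1, (k, g x)).
have dK k x : color_class X c' k x -> color_class X (d k.2.2.1) k.2.1 x /\
    color_class X (d k.2.2.2) k.2.1 x.
  by move=> [Xx <-] /=; split=> //; split=> //; have [_ ->] := Hg x.
have c'r x : c' x \in r'.
  apply: allpairs_f_dep; first by have [] := mP (d (g x).1 x).
  by rewrite mem_filter eqxx mem_enum; have [-> _] := Hg x.
have r'P y : y \in r' -> [/\ y.1 \in r, (m y.2.1).1 = y.1 & y.2.2.1 != y.2.2.2].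
  move=> /allpairsPdep[i [kq [ir]]]; rewrite mem_filter => /andP[/andP[/eqP E n] _] ->.
  by split.
have class_ext y a w : y \in r' -> extends B.+1 (stem (t y.1 a)) (color_class X c' y) w ->
    extends B (stem (t y.1 a)) (color_class X (d y.2.2.1) y.2.1) w /\
    extends B (stem (t y.1 a)) (color_class X (d y.2.2.2) y.2.1) w.
  move=> /r'P[yr _ _] wE; have {}wE := admissible_weaken adm yr (leqnSn _) wE.
  by split; apply: extends_sub wE => x _ /dK[].
have keep y a w : y \in r' -> extends B.+1 (stem (t y.1 a)) (color_class X c' y) w ->
    forall p, p \in avoid (t y.1 a) -> no_bit p.1 p.2 w.
  move=> yr /(class_ext _ _ _ yr)[wE _]; have [_ Em _] := r'P _ yr.
  by have [] := Hd y.2.2.1 (y.2.1, a) w; rewrite /= Em.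
(* The vectors have opposite bits at [pos], and each of the two colorings forbids its own, so no bit
   remains. *)
have new y w : y \in r' -> let s0 := t y.1 (m y.2.1).2 in
    extends B.+1 (stem s0) (color_class X c' y) w ->
    no_bit (phase s0)./2 (proj (pos y.2.2) s) w.
  move=> yr s0 /(class_ext _ _ _ yr)[w1 w2] v v2; have [_ Em n] := r'P _ yr.
  have [_ /(_ erefl (pos y.2.2))] := Hd y.2.2.1 (y.2.1, (m y.2.1).2) w (ltac:(by rewrite /= Em)).
  have [_ /(_ erefl (pos y.2.2))] := Hd y.2.2.2 (y.2.1, (m y.2.1).2) w (ltac:(by rewrite /= Em)).
  rewrite /= Em; have := Hpos y.2.2 n.
  by case: (y.2.2.1 _) (y.2.2.2 _) v v2 => [] [] [|[|v]].
have tnext y : y \in r' -> next_attempt (Y (m y.2.1).2)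
    (next (t y.1 (m y.2.1).2) (pos y.2.2)) (t y.1 (m y.2.1).2).
  move=> yr; have [ir Em n] := r'P _ yr; have [_ od] := mP y.2.1; rewrite Em in od.
  have [[VY V0 Vh Va] bB _] := H _ ir (m y.2.1).2; set s0 := t _ _ in od VY V0 Vh Va bB *.
  have sE : extends B.+1 (stem s0) (color_class X c' y) (stem s0).
    by apply: extends_refl => x Bx; apply: V0; lia.
  split; last first.
    by split=> //=; [move=> p ps; rewrite inE ps orbT | rewrite od].
  split=> //=.
  - by move=> x Bx; apply: V0; lia.
  - move=> e; rewrite uphalf_half od => He.
    have [->|eN] := eqVneq e (phase s0)./2.
      by right; exists (proj (pos y.2.2) s); rewrite mem_head.
    have [|h|[l Hl]] := Vh e; first by lia.
      by left; apply: hits_diagonal_mono h => //; lia.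
    by right; exists l; rewrite inE Hl orbT.
  - by move=> p; rewrite inE => /orP[/eqP->|ps]; [apply: new yr sE | apply: keep yr sE _ ps].
exists (map t' r').
  exists J, r', t', c', B.+1; split=> //; split=> // y yr a.
  have [ir Em n] := r'P _ yr; have [Va bB _] := H _ ir a.
  rewrite /t' /update; case: eqP => [->|_]; last first.
    by split=> //; [exact: leqW | move=> p ps w wE; apply: keep wE _ ps].
  have [Vn _] := tnext y yr; split=> // p; rewrite inE => /orP[/eqP->|ps] w wE.
    exact: new wE.
  exact: keep wE _ ps.
have -> : map t' r' = flatten (map (fun i => [seq t' (i, kq) | kq <- Q i]) r).
  by rewrite map_flatten -map_comp; congr flatten; apply: eq_map => i; rewrite /= -map_comp.
(* Every old task is replaced by smaller ones, possibly by none. *)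
have strict i : i \in r -> forall y, List.In y [seq t' (i, kq) | kq <- Q i] -> next_task Y y (t i).
  move=> ir y; elim: {-2}(Q i) (fun x (h : x \in Q i) => h) => //= kq l IH lQ [<-|]; last first.
    by apply: IH => x xl; apply: lQ; rewrite inE xl orbT.
  exists (m kq.1).2, (next (t i (m kq.1).2) (pos kq.2)); split=> //.
  apply: (tnext (i, kq)); apply: allpairs_f_dep => //; apply: lQ; exact: mem_head.
apply: replace_many => [i ir|]; first by right; apply: strict.
(* The color of [0] shows that [r] is nonempty, hence that the decrease is strict. *)
by exists (c 0); [exact: cr | apply: strict].
Qed.

Lemma not_extendible (X : set nat) (Y : bool -> set nat) :
  unbounded X -> ~ PA_degree X -> (forall x a, Y a x -> X x) ->
  (forall x, X x -> exists a, Y a x) -> (forall a s, Acc (next_attempt (Y a)) s) ->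
  forall S, ~ extendible X Y S.
Proof.
move=> uX nX YX XY AY S.
have: Acc (smaller Y) S.
  by apply: Acc_clos_trans; apply: Acc_replace_one; apply: Acc_next_task.
elim=> {}S _ IH /(extendible_step uX nX YX XY)[S' ES' /IH]; exact.
Qed.

(** If both halves failed, all attempts would be accessible, yet one color with empty attempts is
    extendible. *)
Lemma pigeonhole_not_PA (X A : set nat) : unbounded X -> ~ PA_degree X ->
  exists G, [/\ unbounded G, ~ PA_degree G, forall x, G x -> X x &
    (forall x, G x -> A x) \/ (forall x, G x -> ~ A x)].
Proof.
move=> uX nX; apply: contrapT => /forallNP N.
pose Y a x := X x /\ if a then A x else ~ A x.
apply: (@not_extendible X Y uX nX _ _ _ [:: fun=> Attempt 0 0 0 [::]]).
- by move=> x a [].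
- by move=> x Xx; have [Ax|nAx] := pselect (A x); [exists true | exists false].
- move=> a; apply: Acc_next_attempt => G GY uG; apply: contrapT => nG.
  apply: (N G); split=> // [x /GY[]//|].
  by case: a GY => GY; [left | right] => x /GY[].
- exists unit, [:: tt], (fun=> fun=> Attempt 0 0 0 [::]), (fun=> tt), 0; split=> //.
  split=> // -[] _ a; split=> //; split=> //= x; last by rewrite proj_ge.
  by rewrite /finset_of proj_ge.
Qed.

(** * Cohesive sets *)

(** The bounded quantifiers make this form semirecursive in [Y]. *)
Lemma extendsE b F (Y : set nat) w : extends b F Y w <->
  (forall x, x < b.+1 -> proj x w = proj x F) /\
  (forall x, x < w -> x < b.+1 \/ (proj x w = 0 \/ Y x)).
Proof.
split=> -[E H]; split=> // x.
  by move=> _; have [xb|bx] := ltnP x b.+1; [left | right; apply: H].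
move=> bx; have [/H[|//]|wx] := ltnP x w; first by lia.
by left; apply: proj_ge.
Qed.

(** Mathias forcing: a search through the extensions of [F] inside [X] would
    otherwise compute a PA function from [X]. *)
Lemma meet_requirement (X : set nat) e F b : ~ PA_degree X ->
  (forall x, b < x -> proj x F = 0) ->
  exists w b', [/\ extends b F X w, b < b', w <= b' &
    hits_diagonal e w b' \/ exists n, forall w', extends b' w X w' -> no_bit e n w'].
Proof.
move=> nX F0.
have [[n [v [w [Pv wE ev]]]]|N1] := pselect (exists n v w, [/\ Phi n set0 n v,
    extends b F X w & eval (finset_of w) (decode e) n v]).
  have [u Hu] := eval_use ev; exists w, (b + w + u).+1; split=> //; try lia.
  by left; exists n, v; split=> // B HB; apply: Hu => i iu; rewrite HB //; lia.
have [[n Hn]|N2] := pselect (exists n, forall w, extends b F X w -> no_bit e n w).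
  exists F, (b + F).+1; split; [exact: extends_refl | lia | lia | right].
  exists n => w' wE; apply: Hn; apply: extends_trans wE; first by lia.
  exact: extends_refl.
case: nX; apply: (@semirec_PA_degree _ (fun z => snd_nat z < 2 /\ exists w,
  extends b F X w /\ eval (finset_of w) (decode e) (fst_nat z) (snd_nat z))).
- apply: semirec_and; first by semi.
  apply: semirec_ex; apply: semirec_and; last by apply: semirec_eval; recur.
  apply: (@semirec_comp _ (fun w => extends b F X w) snd_nat); first by recur.
  by apply: (semirec_iff (fun w => iff_sym (extendsE b F X w))); semi.
- move=> n; apply: contrapT => /forallNP Nn; apply: N2; exists n => w wE v v2 ev.
  by apply: (Nn v); rewrite pair_natK1 pair_natK2; split=> //; exists w.
- move=> n v; rewrite pair_natK1 pair_natK2 => -[v2 [w [wE ev]]]; split=> // Pv.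
  by apply: N1; exists n, v, w.
Qed.

(** Queries to the full set can be replaced by the constant [1]; a function computed without oracle
    meets the diagonal at its own index. *)
Lemma not_PA_degree_setT : ~ PA_degree setT.
Proof.
pose fix tr c := match c with
  | Oracle => Comp Succ Zero
  | Pair f g => Pair (tr f) (tr g)
  | Comp f g => Comp (tr f) (tr g)
  | Rec f g => Rec (tr f) (tr g)
  | Mu f => Mu (tr f)
  | c => c
  end.
have trE c : eval setT c = eval set0 (tr c).
  elim: c => //= [|f -> g ->|f -> g ->|f -> g ->|f ->] //.
  apply/funext => x; apply/funext => y; apply/propext; rewrite asboolT //.
  by split=> [->|[z [-> ->]]] //; exists 0.
move=> [f [PAf [e He]]].
pose e' := encode (tr (decode e)); apply: (PAf e' (nat_of_bool (f e'))) => //.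
by rewrite /Phi encodeK -trE; apply: He.
Qed.

Lemma finite_set_leq (C : set nat) b : (forall x, C x -> x <= b) -> finite_set C.
Proof. by move=> Cb; apply: sub_finite_set (finite_II b.+1) => x /Cb. Qed.

Lemma infinite_set_unbounded (C : set nat) : unbounded C -> infinite_set C.
Proof.
move=> uC /finite_seqP[s Es]; have [x [bx]] := uC (\max_(i <- s) i).
by rewrite Es /= => /leq_bigmax_seq => /(_ predT id isT); rewrite leqNgt bx.
Qed.

Theorem theorem3p1 :
  forall R : nat -> set nat,
  exists G : set nat, cohesive R G /\ ~ PA_degree G.
Proof.
move=> R.
(* A state is a stem, its bound and a reservoir. *)
pose inv (s : nat * nat * set nat) :=
  [/\ unbounded s.2, ~ PA_degree s.2 & forall x, s.1.2 < x -> proj x s.1.1 = 0].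
pose next e (s s' : nat * nat * set nat) :=
  [/\ inv s', forall x, s'.2 x -> s.2 x,
     (forall x, s'.2 x -> R e x) \/ (forall x, s'.2 x -> ~ R e x),
     extends s.1.2 s.1.1 s'.2 s'.1.1 &
     [/\ s.1.2 < s'.1.2, exists x, [/\ s.1.2 < x, x <= s'.1.2 & proj x s'.1.1 = 1] &
       hits_diagonal e s'.1.1 s'.1.2 \/
       exists n, forall w, extends s'.1.2 s'.1.1 s'.2 w -> no_bit e n w]].
have /choice[g Hg] : forall es, exists s', inv es.2 -> next es.1 es.2 s'.
  move=> [e [[F b] X]]; have [/= [uX nX F0]|ni] := pselect (inv (F, b, X)); last first.
    by exists (0, 0, X).
  have [X' [uX' nX' XX' RX']] := pigeonhole_not_PA (R e) uX nX.
  have [x [bx X'x]] := uX' b.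
  (* Adding [x] at every stage makes the limit infinite. *)
  have [F1 HF1] := proj_surj x.+1 (fun y => if y < b.+1 then proj y F else y == x).
  have E1 : extends b F X' F1.
    split=> y yb; rewrite HF1; first by rewrite yb ifT //; lia.
    have -> : (y < b.+1) = false by lia.
    by have [->|_] := eqVneq y x; [right | left; rewrite if_same].
  have F1x : proj x F1 = 1.
    by rewrite HF1 ltnSn eqxx; have -> : (x < b.+1) = false by lia.
  have F10 y : x < y -> proj y F1 = 0 by move=> xy; rewrite HF1 ifN //; lia.
  have [F2 [b2 [E2 xb2 F2b Hreq]]] := meet_requirement e nX' F10.
  exists (F2, b2, X') => _; split=> //=.
  - by split=> //= y yb; apply: proj_ge; lia.
  - by apply: extends_trans E1 E2; lia.
  - split=> //; first by lia.
    by exists x; split=> //; [lia | case: E2 => ->].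
pose s := fix s t := if t is t'.+1 then g (t', s t') else (0, 0, setT).
have s_inv t : inv (s t).
  elim: t => [|t IH]; last by have [] := Hg (t, s t) IH.
  split=> [b||x _]; [by exists b.+1 | exact: not_PA_degree_setT | exact: proj_ge].
have s_next t : next t (s t) (s t.+1) by exact: Hg (t, s t) (s_inv t).
pose F t := (s t).1.1; pose b t := (s t).1.2.
have bS t : b t < b t.+1 by have [_ _ _ _ []] := s_next t.
have bge t : t <= b t by elim: t => // t IH; have := bS t; lia.
have bmono t k : b t <= b (t + k).
  by elim: k => [|k IH]; rewrite ?addn0 // addnS; have := bS (t + k); lia.
have FS t x : x < (b t).+1 -> proj x (F t.+1) = proj x (F t).
  by have [_ _ _ [E _] _] := s_next t; apply: E.
have ext t k : extends (b t) (F t) (s t).2 (F (t + k)) /\ forall x, (s (t + k)).2 x -> (s t).2 x.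
  elim: k => [|k [IH IHs]]; first by rewrite addn0; split=> //; apply: extends_refl; have [] := s_inv t.
  rewrite addnS; have [_ sub _ E _] := s_next (t + k); split=> [|x /sub/IHs//].
  apply: extends_trans IH _; last by apply: extends_sub E => x _ /sub/IHs.
  exact: bmono.
exists (fun x => finset_of (F x) x); split; last first.
  apply: (limit_not_PA bS FS) => e; exists e.+1.
  have [_ _ _ _ [_ _ [h|[n Hn]]]] := s_next e; [by left | right; exists n => t v et].
  by apply: Hn; rewrite -(subnKC et); have [] := ext e.+1 (t - e.+1).
have Ag := limit_set_agree bS FS.
split=> [|n].
  apply: infinite_set_unbounded => m; have [_ _ _ _ [_ [x [mx xb px]] _]] := s_next m.
  by exists x; split; [have := bge m; rewrite /b; lia | apply/(Ag m.+1)].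
(* Beyond [b n.+1] all elements come from reservoir [n.+1], which lies inside [R n] or misses it. *)
have late x : b n.+1 < x -> finset_of (F x) x -> (s n.+1).2 x.
  move=> bx Gx; have nx : n.+1 <= x by have := bge n.+1; lia.
  have [[_ /(_ x bx)]] := ext n.+1 (x - n.+1); rewrite subnKC //.
  by case=> // E; move: Gx; rewrite /finset_of E.
have [_ _ [sR|sR] _ _] := s_next n; [left | right]; apply: (@finite_set_leq _ (b n.+1)).
  by move=> x [Gx nR]; rewrite leqNgt; apply/negP => /late/(_ Gx)/sR.
by move=> x [Gx nR]; rewrite leqNgt; apply/negP => /late/(_ Gx)/sR.
Qed.
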